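(* Let $d\ge 3$ be an integer, let $\mathbb{k}$ be a field of characteristic $0$ or of characteristic greater than $d$, and let $r>1$ and $n>1$ be integers with $(n,d)\neq(2,3)$. Let $x=(x_1,\dots,x_r)$ and $y=(y_1,\dots,y_n)$ be two systems of independent indeterminates over $\mathbb{k}$. Then there do not exist $z_1,\dots,z_{n+1}\in\mathbb{k}(x)[y]$, each of which is a linear form in $y_1,\dots,y_n$ with coefficients in the rational function field $\mathbb{k}(x)=\mathbb{k}(x_1,\dots,x_r)$, such that \[ (x_1^d + x_2^d + \cdots + x_r^d)\,(y_1^d + y_2^d + \cdots + y_n^d) = z_1^d + z_2^d + \cdots + z_{n+1}^d \] holds in $\mathbb{k}(x)[y]$.
   Context: A linear form in $y$ with coefficients in $\mathbb{k}(x)$ is an expression $\sum_{j=1}^n c_j y_j$ with all $c_j\in\mathbb{k}(x)$ (the zero form is allowed). *)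

(* Defs.v *)
From HB Require Import structures.
From mathcomp Require Import all_boot all_order all_algebra.
From mathcomp Require Import mpoly.

Set Implicit Arguments.
Unset Strict Implicit.
Unset Printing Implicit Defensive.

Import GRing.Theory.
Local Open Scope ring_scope.

Notation ratfun k r := {fraction {mpoly k[r]}}.

Definition is_linear_form (n : nat) (K : fieldType) (z : {mpoly K[n]}) : Prop :=
  exists c : 'I_n -> K, z = \sum_(j < n) (c j)%:MP * 'X_j.

(* Main.v *)
(* Write s = x_1^d + ... + x_r^d and z_i = sum_j c_ij y_j.  Iterated partial
   derivatives turn the identity into: the sum over i of c_ij1 ... c_ijd is s
   if all the indices agree and 0 otherwise.  Hence C = (c_ij) has rank n, its
   left kernel is a line, and every product of d - 1 columns that are not all
   equal lies on that line.  Comparing such products, either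
   - for some columns j, k, the rows where both are nonzero form a nonempty set T
     of proportional rows; then the sum of z_i^d over T is 0 and at most n - 1
     forms remain, contradicting the rank; or
   - some column has disjoint support from all the others (this is where
     (n, d) = (2, 3) must be excluded), and comparison with another vector of
     the left kernel leaves it a single nonzero entry c, so that s = c^d.
   The second case is impossible: as a polynomial in x_1, s is x_1^d plus a
   nonzero constant, which is coprime to its derivative. *)
Require Import Defs.
From mathcomp Require Import all_boot all_order all_algebra.
From mathcomp Require Import mpoly.
From mathcomp Require Import ring.

Import GRing.Theory.
Local Open Scope ring_scope.

(** * Arithmetic: a sum of at least two d-th powers of indeterminates is not a d-th power *)

Lemma fraction_num_den (R : idomainType) (x : {fraction R}) :
  exists a b : R, b != 0 /\ x * FracField.tofrac b = FracField.tofrac a.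
Proof.
elim/quotW: x => -[[a b] /= nb]; exists a, b; split=> //.
rewrite !piE; apply/eqP; rewrite /FracField.mulf /=.
rewrite eqmodE /= /FracField.equivf /= !numden_Ratio ?oner_eq0 ?mulf_neq0 ?oner_eq0 //.
by rewrite !mulr1 mulrC.
Qed.

Lemma fact_natr_neq0 (k : fieldType) (d : nat) :
  [pchar k] =i pred0 \/ (exists2 p : nat, p \in [pchar k] & (d < p)%N) ->
  d`!%:R != 0 :> k.
Proof.
move=> hk.
have natr_neq0 m : (0 < m <= d)%N -> m%:R != 0 :> k.
  case/andP=> m_gt0 le_md; case: hk => [/pcharf0P -> |[p pk lt_dp]].
    by rewrite -lt0n.
  rewrite -(dvdn_pcharf pk); apply: contraL (leq_ltn_trans le_md lt_dp) => /(dvdn_leq m_gt0).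
  by rewrite -leqNgt.
suff: forall m, (m <= d)%N -> m`!%:R != 0 :> k by apply.
elim=> [|m IHm] le_md; first by rewrite oner_neq0.
by rewrite factS natrM mulf_neq0 ?IHm ?(ltnW le_md) // natr_neq0.
Qed.

Lemma XnDC_neq_dth_power (K : fieldType) (d : nat) (c : K) (a b : {poly K}) :
  (1 < d)%N -> d%:R != 0 :> K -> c != 0 -> b != 0 ->
  a ^+ d != ('X^d + c%:P) * b ^+ d.
Proof.
move=> d_gt1 d_neq0 c_neq0 b_neq0; apply/eqP => abE.
have d_gt0 := ltnW d_gt1.
set P := 'X^d + c%:P in abE.
have szP : size P = d.+1 by rewrite /P size_XnaddC.
pose g := gcdp a b.
have g_neq0 : g != 0 by rewrite gcdp_eq0 negb_and b_neq0 orbT.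
pose a' := a %/ g; pose b' := b %/ g.
have aE : a = a' * g by rewrite divpK // dvdp_gcdl.
have bE : b = b' * g by rewrite divpK // dvdp_gcdr.
have cop : coprimep a' b' by rewrite coprimep_div_gcd // b_neq0 orbT.
have {}abE : a' ^+ d = P * b' ^+ d.
  apply: (mulIf (expf_neq0 d g_neq0)).
  by rewrite -mulrA -!exprMn -aE -bE.
have /size_poly1P[u u_neq0 b'E] : size b' == 1%N.
  rewrite -coprimepp; apply: (coprimep_dvdr (p := a' ^+ d)); last exact: coprimep_expl.
  by rewrite abE dvdp_mull // dvdp_exp.
pose q := (u^-1)%:P * a'.
have PE : P = q ^+ d.
  rewrite exprMn abE b'E mulrCA -exprMn -polyCM mulVf //.
  by rewrite polyC1 expr1n mulr1.
have q_dvdP : q %| P by rewrite PE dvdp_exp.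
have q_dvdP' : q %| P^`().
  by rewrite PE deriv_exp -mulr_natr dvdp_mulr // dvdp_mull // dvdp_exp // -subn1 subn_gt0.
have dXP : P *+ d - 'X * P^`() = (c *+ d)%:P.
  rewrite /P derivD derivXn derivC addr0 mulrnAr -exprS prednK //.
  by rewrite mulrnDl addrAC subrr add0r polyCMn.
have: q %| (c *+ d)%:P.
  by rewrite -dXP dvdp_sub ?dvdp_mull // -mulr_natr dvdp_mulr.
have cd_neq0 : c *+ d != 0 by rewrite -mulr_natr mulf_neq0.
move/dvdp_leq; rewrite polyC_eq0 size_polyC cd_neq0 => /(_ isT) sz_q.
have := size_exp q d.
rewrite -PE szP /= => d_eq; move: d_gt0; rewrite d_eq.
by case: (size q) sz_q => [|[]].
Qed.

Section SumOfPowers.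
Variables (k : fieldType) (r d : nat).
Local Notation F := (ratfun k r).
Local Notation tofrac := (@FracField.tofrac {mpoly k[r]}).

(** Views a polynomial as univariate in ['X_i0]. The other indeterminates are sent to constants of
    the whole field [F], so no fraction field in fewer variables has to be built. *)
Local Notation univ_at i0 := (mmap (polyC \o tofrac \o @mpolyC r k)
  (fun i => if i == i0 then 'X else (tofrac 'X_i)%:P)).

(** Evaluation undoes the substitution, so a nonzero denominator keeps a nonzero image. *)
Lemma univ_at_horner i0 p : (univ_at i0 p).[tofrac 'X_i0] = tofrac p.
Proof.
elim/mpolyind: p => [|c m p _ _ IHp]; first by rewrite mmap0 tofrac0 horner0.
rewrite mmapD tofracD hornerD; congr (_ + _); last exact: IHp.
rewrite mmapZ mmapX hornerM hornerC -mul_mpolyC tofracM; congr (_ * _).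
rewrite /mmap1 horner_prod (mpolyXE_id k m) rmorph_prod; apply: eq_bigr => i _.
rewrite horner_exp rmorphXn; congr (_ ^+ _).
by case: eqP => [->|_]; rewrite ?hornerX ?hornerC.
Qed.

Lemma sum_powers_neq_dth_power (f : F) :
  (1 < r)%N -> (1 < d)%N -> d%:R != 0 :> k -> tofrac (\sum_(i < r) 'X_i ^+ d) != f ^+ d.
Proof.
move=> r_gt1 d_gt1 d_neq0; apply/eqP=> sE.
have [a [b [b_neq0 fE]]] := fraction_num_den _ f.
pose i0 := Ordinal (ltnW r_gt1); pose i1 := Ordinal r_gt1.
pose c := \sum_(i < r | i != i0) 'X_i ^+ d : {mpoly k[r]}.
have c_neq0 : c != 0.
  (* At the point with coordinate 1 at [i1] and 0 elsewhere, [c] takes the value 1. *)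
  apply/eqP => /(congr1 (meval (fun i => (i == i1)%:R))).
  rewrite rmorph_sum (bigD1 i1) //= big1 => [|i /andP[_ ni1]].
    by rewrite rmorphXn /= mevalXU eqxx expr1n addr0 meval0 => /eqP; rewrite oner_eq0.
  by rewrite rmorphXn /= mevalXU (negPf ni1) expr0n gtn_eqF // ltnW.
have abE : a ^+ d = (\sum_(i < r) 'X_i ^+ d) * b ^+ d.
  apply/eqP; rewrite -tofrac_eq rmorphM /= sE !rmorphXn /=.
  by rewrite -exprMn fE.
have dF : d%:R != 0 :> F.
  by rewrite -(rmorph_nat tofrac) tofrac_eq0 -mpolyC_nat mpolyC_eq0.
have cE : univ_at i0 c = (tofrac c)%:P.
  rewrite !rmorph_sum; apply: eq_bigr => i /negPf ni0.
  by rewrite !rmorphXn /= mmapX mmap1U ni0.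
have sumE : univ_at i0 (\sum_(i < r) 'X_i ^+ d) = 'X^d + (tofrac c)%:P.
  rewrite (bigD1 i0) //= mmapD -cE; congr (_ + _).
  by rewrite rmorphXn /= mmapX mmap1U eqxx.
have b'_neq0 : univ_at i0 b != 0.
  apply: contraNneq b_neq0 => /(congr1 (horner^~ (tofrac 'X_i0))).
  by rewrite univ_at_horner horner0 => /eqP; rewrite tofrac_eq0.
have tc_neq0 : tofrac c != 0 by rewrite tofrac_eq0.
have /eqP := XnDC_neq_dth_power F d _ (univ_at i0 a) _ d_gt1 dF tc_neq0 b'_neq0.
apply; rewrite -sumE -[LHS](rmorphXn _ d a) abE [LHS]rmorphM.
by rewrite [X in _ * X = _]rmorphXn.
Qed.
End SumOfPowers.

(** * From the polynomial identity to relations between coefficients *)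

Section DthPowerSums.
Variables (F : fieldType) (n d : nat).

Lemma mderiv_exp (i : 'I_n) (p : {mpoly F[n]}) (m : nat) :
  mderiv i (p ^+ m) = m%:R * mderiv i p * p ^+ m.-1.
Proof.
elim: m => [|m IHm]; first by rewrite expr0 -mpolyC1 mderivC !mul0r.
rewrite exprS mderivM IHm /= -natr1.
by case: m {IHm} => [|m] /=; rewrite ?exprS; ring.
Qed.

Lemma foldr_mderiv_linear_form_exp (c : 'I_n -> F) (js : seq 'I_n) :
  (size js <= d)%N ->
  foldr (@mderiv n F) ((\sum_(j < n) (c j)%:MP * 'X_j) ^+ d) js =
  ((d ^_ size js)%:R * \prod_(l <- js) c l)%:MP
    * (\sum_(j < n) (c j)%:MP * 'X_j) ^+ (d - size js).
Proof.
set z := \sum_(j < n) _.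
have dz l : mderiv l z = (c l)%:MP.
  rewrite raddf_sum (bigD1 l) //= mderiv_mulC mderivX mnm1E eqxx scale1r.
  have -> : (U_(l) - U_(l) = 0 :> 'X_{1..n})%MM by rewrite -{1}[U_(l)%MM]add0m addmK.
  rewrite mpolyX0 mulr1 big1 ?addr0 // => j /negPf jl.
  by rewrite mderiv_mulC mderivX mnm1E jl scale0r mulr0.
elim: js => [|l js IHjs] /= szjs.
  by rewrite ffactn0 big_nil mulr1 mpolyC1 mul1r subn0.
rewrite IHjs 1?ltnW // mderiv_mulC mderiv_exp dz big_cons ffactnSr natrM.
rewrite subnS !mpolyCM !mpolyC_nat; ring.
Qed.

(** Differentiating along [js] leaves [d]![times a product of coefficients for each form. The left
    side is handled by the same computation]D[, each]'X_j[being the linear form with Kronecker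
    coefficients; then]d[!] cancels. *)
Lemma dth_power_sum_coef (I : finType) (c : I -> 'I_n -> F) (s : F) :
  d`!%:R != 0 :> F ->
  s%:MP * (\sum_(j < n) 'X_j ^+ d)
    = \sum_i (\sum_(j < n) (c i j)%:MP * 'X_j) ^+ d ->
  forall js : seq 'I_n, size js = d ->
  \sum_i \prod_(l <- js) c i l = s * \sum_(j < n) \prod_(l <- js) (j == l)%:R.
Proof.
move=> d_neq0 sE js szjs.
have XE (j : 'I_n) : 'X_j = \sum_(l < n) ((j == l)%:R)%:MP * 'X_l :> {mpoly F[n]}.
  rewrite (bigD1 j) //= eqxx mpolyC1 mul1r big1 ?addr0 // => l.
  by rewrite eq_sym => /negPf ->; rewrite mpolyC0 mul0r.
have D (J : finType) (b : J -> 'I_n -> F) :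
    foldr (@mderiv n F) (\sum_j (\sum_(l < n) (b j l)%:MP * 'X_l) ^+ d) js
    = (d`!%:R * \sum_j \prod_(l <- js) b j l)%:MP.
  have -> : foldr (@mderiv n F) (\sum_j (\sum_(l < n) (b j l)%:MP * 'X_l) ^+ d) js
      = \sum_j foldr (@mderiv n F) ((\sum_(l < n) (b j l)%:MP * 'X_l) ^+ d) js.
    by elim: (js) => //= l js' ->; rewrite raddf_sum.
  rewrite mulr_sumr raddf_sum; apply: eq_bigr => j _ /=.
  by rewrite foldr_mderiv_linear_form_exp szjs // ffactnn subnn mulr1.
have DC p : foldr (@mderiv n F) (s%:MP * p) js = s%:MP * foldr (@mderiv n F) p js.
  by elim: (js) => //= l js' ->; rewrite mderiv_mulC.
have := congr1 (fun p => foldr (@mderiv n F) p js) sE.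
rewrite DC D (eq_bigr (fun j => (\sum_(l < n) ((j == l)%:R)%:MP * 'X_l) ^+ d)).
  rewrite D -mpolyCM => /eqP; rewrite mpolyC_eq => /eqP/esym; rewrite mulrCA; exact: mulfI.
by move=> j _; rewrite -XE.
Qed.

(** The relation with [e] gives the matrix of [c] a left inverse up to the scalar [s], so its rank
    is [n] and its left kernel is a line. A general [e] is allowed because the lemma is reused after
    some rows have been erased. *)
Lemma left_kernel_minor (c e : 'I_n.+1 -> 'I_n -> F) (s : F) (u v : 'I_n.+1 -> F) :
  s != 0 -> (forall j l, \sum_i e i j * c i l = s *+ (j == l)) ->
  (forall l, \sum_i u i * c i l = 0) -> (forall l, \sum_i v i * c i l = 0) ->
  forall p q, u p * v q = u q * v p.
Proof.
move=> s_neq0 ecE uc vc p q.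
pose C : 'M[F]_(n.+1, n) := \matrix_(i, l) c i l.
pose row (w : 'I_n.+1 -> F) : 'rV[F]_n.+1 := \row_i w i.
have rowC w : (forall l, \sum_i w i * c i l = 0) -> row w *m C = 0.
  move=> wc; apply/rowP=> l; rewrite !mxE -[RHS](wc l).
  by apply: eq_bigr => i _; rewrite !mxE.
have rankC : \rank C = n.
  apply/eqP; rewrite eqn_leq rank_leq_col -{1}(mxrank1 F n).
  apply: mxrankS; apply/submxP; exists (s^-1 *: \matrix_(j, i) e i j).
  rewrite -scalemxAl; apply/matrixP => j l; rewrite !mxE.
  under eq_bigr do rewrite !mxE.
  by rewrite ecE mulrnAr mulVf.
have rankK : \rank (kermx C) = 1%N by rewrite mxrank_ker rankC subSnn.
have [u0 | u_neq0] := eqVneq (row u) 0.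
  have uE i : u i = 0 by have := congr1 (fun w : 'rV_n.+1 => w 0 i) u0; rewrite !mxE.
  by rewrite !uE !mul0r.
have uK : (row u <= kermx C)%MS by apply/sub_kermxP/rowC.
have Ku : (kermx C <= row u)%MS.
  by rewrite -(geq_leqif (mxrank_leqif_sup uK)) rankK rank_rV u_neq0.
have /sub_rVP[a vE] : (row v <= row u)%MS.
  by apply: submx_trans Ku; apply/sub_kermxP/rowC.
have {}vE i : v i = a * u i by have := congr1 (fun w : 'rV_n.+1 => w 0 i) vE; rewrite !mxE.
by rewrite !vE; ring.
Qed.

End DthPowerSums.

(** * Supports and proportionality of the columns of the coefficient matrix *)

Section Decomposition.
Variables (F : fieldType) (n d : nat) (c : 'I_n.+1 -> 'I_n -> F) (s : F).
Hypotheses (d_ge3 : (3 <= d)%N) (s_neq0 : s != 0).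
Hypothesis coef_pure : forall j, \sum_i c i j ^+ d = s.
Hypothesis coef_mixed : forall (js : seq 'I_n) (j k : 'I_n),
  size js = d -> j \in js -> k \in js -> j != k ->
  \sum_i \prod_(l <- js) c i l = 0.

Let d_gt0 : (0 < d)%N := ltnW (ltnW d_ge3).
Let d1_gt0 : (0 < d.-1)%N.
Proof. by rewrite -subn1 subn_gt0 ltnW. Qed.

Definition left_kernel (u : 'I_n.+1 -> F) := forall l, \sum_i u i * c i l = 0.

Lemma coef_pure_mixed (j l : 'I_n) :
  \sum_i c i j ^+ d.-1 * c i l = s *+ (j == l).
Proof.
case: eqVneq => [<-|jl].
  rewrite -[RHS](coef_pure j); apply: eq_bigr => i _.
  by rewrite -exprSr prednK.
rewrite mulr0n -[RHS](@coef_mixed (l :: nseq d.-1 j) j l) //=.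
- by apply: eq_bigr => i _; rewrite big_cons mulrC big_nseq iter_mulr_1.
- by rewrite size_nseq prednK.
- by rewrite inE mem_nseq d1_gt0 eqxx orbT.
- by rewrite inE eqxx.
Qed.

Lemma left_kernel_prod (js : seq 'I_n) (j k : 'I_n) :
  size js = d.-1 -> j \in js -> k \in js -> j != k ->
  left_kernel (fun i => \prod_(l <- js) c i l).
Proof.
move=> szjs jjs kjs jk l.
rewrite -[RHS](@coef_mixed (l :: js) j k) ?inE ?jjs ?kjs ?orbT //=.
  by apply: eq_bigr => i _; rewrite big_cons mulrC.
by rewrite szjs prednK.
Qed.

Lemma left_kernel_minor_eq (u v : 'I_n.+1 -> F) p q :
  left_kernel u -> left_kernel v -> u p * v q = u q * v p.
Proof. by move=> hu hv; apply: (left_kernel_minor _ _ _ _ _ _ _ s_neq0 coef_pure_mixed). Qed.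

Lemma left_kernel_monomial (j k : 'I_n) :
  j != k -> left_kernel (fun i => c i k * c i j ^+ d.-2).
Proof.
move=> jk l.
have d2 : (0 < d.-2)%N by rewrite -subn2 subn_gt0.
rewrite -[RHS](@left_kernel_prod (k :: nseq d.-2 j) j k _ _ _ jk l) /=.
- by apply: eq_bigr => i _; rewrite big_cons big_nseq iter_mulr_1.
- by rewrite size_nseq prednK.
- by rewrite inE mem_nseq d2 eqxx orbT.
- by rewrite inE eqxx.
Qed.

(* The rows [p] with [c p j * c p k != 0] contribute [(\sum_p t_p ^+ d) * L ^+ d]
   for one linear form [L], and the coefficient of [y_j^(d-1) y_k] makes this
   vanish.  At most [n - 1] forms are left to represent a form of rank [n]. *)
Lemma proportional_rows_False (j k : 'I_n) (q : 'I_n.+1) :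
  j != k -> c q j * c q k != 0 ->
  (forall p, c p j * c p k != 0 ->
     forall l, c p l * c q j = c p j * c q l) -> False.
Proof.
move=> jk; rewrite mulf_eq0 negb_or => /andP[qj qk] rowsE.
pose T i := c i j * c i k != 0; pose t i := c i j / c q j.
have Tq : T q by rewrite /T mulf_neq0.
have tE p l : T p -> c p l = t p * c q l.
  by move=> Tp; apply: (mulIf qj); rewrite rowsE // /t mulrAC divfK.
have sumT0 (l m : 'I_n) : \sum_(i | T i) c i l ^+ d.-1 * c i m =
    (\sum_(i | T i) t i ^+ d) * (c q l ^+ d.-1 * c q m).
  rewrite mulr_suml; apply: eq_bigr => i Ti.
  by rewrite !(tE i _ Ti) exprMn -[in t i ^+ d](prednK d_gt0) exprS; ring.
have t0 : \sum_(i | T i) t i ^+ d = 0.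
  have := coef_pure_mixed j k; rewrite (negPf jk) mulr0n (bigID T) /= sumT0.
  rewrite [X in _ + X]big1 => [|i].
    rewrite addr0 => /eqP; rewrite mulf_eq0 => /orP[/eqP //|].
    by rewrite mulf_eq0 expf_eq0 (negPf qj) (negPf qk) andbF.
  rewrite negbK mulf_eq0 => /orP[]/eqP-> ; last by rewrite mulr0.
  by rewrite expr0n gtn_eqF // mul0r.
(* If [q] were alone in [T], the sum [t0] would reduce to [t q ^+ d = 1]. *)
have [p Tp pq] : exists2 p, T p & p != q.
  apply/exists_inP; apply: contraT; rewrite negb_exists_in => /forall_inP noT.
  have := t0; rewrite (bigD1 q) //= big1 => [|i /andP[Ti iq]].
    by rewrite /t divff // expr1n addr0 => /eqP; rewrite oner_eq0.
  by have := noT i Ti; rewrite iq.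
(* Erasing the rows in [T] keeps the duality relation, since their total contribution is zero. The
   unit vectors at [p] and [q] then both lie in the left kernel, which is only a line. *)
pose c' i l := if T i then 0 else c i l.
pose e' i l := if T i then 0 else c i l ^+ d.-1.
have e'c' l m : \sum_i e' i l * c' i m = s *+ (l == m).
  rewrite -coef_pure_mixed [RHS](bigID T) /= sumT0 t0 mul0r add0r.
  rewrite [RHS]big_mkcond /=; apply: eq_bigr => i _.
  by rewrite /e' /c'; case: (T i) => //=; rewrite mul0r.
have ker r : T r -> forall l, \sum_i (i == r)%:R * c' i l = 0.
  move=> Tr l; rewrite big1 // => i _; case: eqP => [->|_]; last by rewrite mul0r.
  by rewrite /c' Tr mulr0.
have := left_kernel_minor _ _ _ _ _ _ _ s_neq0 e'c' (ker p Tp) (ker q Tq) p q.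
by rewrite !eqxx eq_sym (negPf pq) mul0r mulr1 => /eqP; rewrite oner_eq0.
Qed.

Definition isolated_column (l : 'I_n) :=
  forall i m, m != l -> c i l * c i m = 0.

(** If column [l] has a single nonzero entry, [coef_pure] makes [s] its d-th power. Two rows [p],
    [q] in its support vanish in all other columns, so they are proportional, and their linear
    relation is a kernel vector supported there. *)
Lemma isolated_column_cases (l : 'I_n) :
  isolated_column l ->
  (exists g, s = g ^+ d) \/
  exists v p, [/\ left_kernel v, v p != 0, c p l != 0
                & forall t, c t l = 0 -> v t = 0].
Proof.
move=> iso.
have [p pl] : exists p, c p l != 0.
  apply/existsP; apply: contraNT s_neq0; rewrite negb_exists => /forallP col0.
  rewrite -(coef_pure l) big1 // => i _.
  by have := col0 i; rewrite negbK => /eqP ->; rewrite expr0n gtn_eqF.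
have [/existsP[q /andP[qp ql]] | noq] := boolP [exists q, (q != p) && (c q l != 0)].
  right; exists (fun i => c q l *+ (i == p) - c p l *+ (i == q)), p; split=> //.
  - move=> m; rewrite (bigD1 p) //= (bigD1 q) //= big1 => [|i /andP[/negPf ip /negPf iq]].
      rewrite !eqxx (negPf qp) eq_sym (negPf qp) !mulr0n subr0 sub0r !mulr1n addr0.
      have [->|ml] := eqVneq m l; first by ring.
      have row0 r : c r l != 0 -> c r m = 0.
        by move=> rl; apply: (mulfI rl); rewrite iso // mulr0.
      by rewrite !row0 // !mulr0 addr0.
    by rewrite ip iq subr0 mul0r.
  - by rewrite eqxx [p == q]eq_sym (negPf qp) subr0.
  - move=> t tl; case: eqVneq => [tp|_]; first by rewrite -tp tl eqxx in pl.
    by case: eqVneq => [tq|_]; [rewrite -tq tl eqxx in ql | rewrite subr0].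
left; exists (c p l); rewrite -(coef_pure l) (bigD1 p) //= big1 ?addr0 // => i ip.
move: noq; rewrite negb_exists => /forallP/(_ i); rewrite ip negbK => /eqP ->.
by rewrite expr0n gtn_eqF.
Qed.

(** A kernel vector that is nonzero off the support of column [l] cannot be proportional to one
    supported inside it, which rules out the second case. *)
Lemma isolated_column_dth_power (l : 'I_n) (u : 'I_n.+1 -> F) t :
  isolated_column l -> left_kernel u -> u t != 0 -> c t l = 0 ->
  exists g, s = g ^+ d.
Proof.
move=> iso ker_u ut tl; have [//|[v [p [ker_v vp _ v0]]]] := isolated_column_cases l iso.
have := left_kernel_minor_eq u v t p ker_u ker_v; rewrite (v0 t tl) mulr0 => /eqP.
by rewrite mulf_eq0 (negPf ut) (negPf vp).
Qed.

Lemma dth_power_of_decomposition :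
  (1 < n)%N -> (n, d) <> (2, 3)%N -> exists g, s = g ^+ d.
Proof.
move=> n_gt1 nd.
have [noT | ] := boolP [forall i, forall j, forall k, (j != k) ==> (c i j * c i k == 0)].
  have iso l : isolated_column l.
    move=> i m ml; apply/eqP.
    by move/forallP/(_ i)/forallP/(_ l)/forallP/(_ m): noT; rewrite eq_sym ml.
  pose j0 := Ordinal (ltnW n_gt1); pose j1 := Ordinal n_gt1.
  (* All columns are isolated here: the kernel vector found for [j1] is nonzero at a row where
     column [j0] vanishes. *)
  have [//|[v [p [ker_v vp pj1 _]]]] := isolated_column_cases j1 (iso j1).
  apply: (isolated_column_dth_power j0 v p) => //.
  by apply: (mulfI pj1); rewrite iso // mulr0.
rewrite negb_forall => /existsP[q]; rewrite negb_forall => /existsP[j].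
rewrite negb_forall => /existsP[k]; rewrite negb_imply => /andP[jk Tq].
have kj : k != j by rewrite eq_sym.
(* On the support of column [j'], all the other columns are pairwise proportional: compare two
   monomial kernel vectors and cancel the powers of column [j']. *)
have R (j' k' l : 'I_n) (p p' : 'I_n.+1) : j' != k' -> l != j' ->
    c p j' != 0 -> c p' j' != 0 -> c p k' * c p' l = c p' k' * c p l.
  move=> jk' lj pj p'j.
  have jl : j' != l by rewrite eq_sym.
  have := left_kernel_minor_eq _ _ p p' (left_kernel_monomial j' k' jk')
    (left_kernel_monomial j' l jl) => E.
  have nz : c p j' ^+ d.-2 * c p' j' ^+ d.-2 != 0 by rewrite mulf_neq0 // expf_neq0.
  by apply: (mulIf nz); rewrite mulrACA E; ring.
have TE p : c p j * c p k != 0 -> c p j != 0 /\ c p k != 0.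
  by rewrite mulf_eq0 negb_or => /andP.
(* [R] centred at [k] gives the proportionality of rows except in column [k] itself. For [3 < d] the
   monomial with exponents 2 at [k] and [d - 3] at [j] is still mixed, and comparison with exponents
   1 and [d - 2] supplies the missing case. *)
have [d_gt3 | d_le3] := ltnP 3 d.
  exfalso; apply: (proportional_rows_False j k q) => // p Tp l.
  have [[pj pk] [qj qk]] := (TE p Tp, TE q Tq).
  have [-> | lk] := eqVneq l k; last by rewrite [LHS]mulrC -(R k j l).
  have ker2 : left_kernel (fun i => c i k * (c i k * c i j ^+ d.-2.-1)).
    move=> m; have d3 : (0 < d.-2.-1)%N by case: (d) d_gt3 => [|[|[|[]]]].
    rewrite -[RHS](@left_kernel_prod (k :: k :: nseq d.-2.-1 j) j k _ _ _ jk m) /=.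
    + by apply: eq_bigr => i _; rewrite !big_cons big_nseq iter_mulr_1.
    + by rewrite size_nseq !prednK // -subn2 subn_gt0.
    + by rewrite !inE mem_nseq d3 eqxx !orbT.
    + by rewrite inE eqxx.
  have E := left_kernel_minor_eq _ _ p q (left_kernel_monomial j k jk) ker2.
  have nz : c p k * c q k * (c p j ^+ d.-2.-1 * c q j ^+ d.-2.-1) != 0.
    by rewrite !mulf_neq0 // expf_neq0.
  apply: (mulIf nz); have d2 : d.-2 = d.-2.-1.+1 by rewrite prednK // -subn2 subn_gt0 ltnW.
  move: E; rewrite d2 !exprS => E.
  by transitivity (c q k * (c q j * c q j ^+ d.-2.-1) * (c p k * (c p k * c p j ^+ d.-2.-1)));
    [ring | rewrite -E; ring].
have d3 : d = 3%N by apply/eqP; rewrite eqn_leq d_le3.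
have n_gt2 : (2 < n)%N.
  by rewrite ltn_neqAle n_gt1 andbT; apply/eqP => n2; apply: nd; rewrite -n2 d3.
(* For [d = 3], a nonzero entry in a third column [l] replaces that monomial: columns [j] and [k]
   are each compared with column [l]. *)
have [/existsP[p /andP[Tp /existsP[l /and3P[lj lk pl]]]] | noL] :=
    boolP [exists p, (c p j * c p k != 0) && [exists l, [&& l != j, l != k & c p l != 0]]].
  exfalso; apply: (proportional_rows_False j k p) => // r Tr m.
  have [[pj pk] [rj rk]] := (TE p Tp, TE r Tr).
  have [-> | mk] := eqVneq m k; last by rewrite [LHS]mulrC -(R k j m).
  apply: (mulIf pl).
  have E1 : c r k * c p l = c p k * c r l by apply: (R j k l).
  have E2 : c r j * c p l = c p j * c r l by apply: (R k j l).
  by rewrite mulrAC E1 [RHS]mulrAC E2; ring.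
have [l lj lk] : exists2 l : 'I_n, l != j & l != k.
  have /card_gt0P[l] : (0 < #|~: [set j; k]|)%N.
    have := cardsC [set j; k]; rewrite cards2 jk card_ord => cardE.
    by rewrite -(ltn_add2l 2) addn0 cardE.
  by rewrite !inE negb_or => /andP[lj lk]; exists l.
have ql : c q l = 0.
  apply/eqP; apply: contraNT noL => ql; apply/existsP; exists q.
  by rewrite Tq; apply/existsP; exists l; rewrite lj lk.
have ker2 (a b : 'I_n) : a != b -> left_kernel (fun i => c i a * c i b).
  move=> ab m; rewrite -[RHS](@left_kernel_prod [:: a; b] a b _ _ _ ab m) ?d3 ?inE ?eqxx ?orbT //.
  by apply: eq_bigr => i _; rewrite !big_cons big_nil mulr1.
(* The product of columns [j] and [k] is a kernel vector nonzero at [q], while the product of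
   columns [l] and [m] vanishes at [q]; being proportional to the former, it vanishes everywhere, so
   column [l] is isolated. *)
apply: (isolated_column_dth_power l _ q _ (ker2 j k jk)) => //.
move=> i m ml; apply: (mulfI Tq); rewrite mulr0.
have lm : l != m by rewrite eq_sym.
by rewrite (left_kernel_minor_eq _ _ q i (ker2 j k jk) (ker2 l m lm)) ql mul0r mulr0.
Qed.
End Decomposition.

Theorem theorem3p3 (d : nat) (hd : (3 <= d)%N)
    (k : fieldType)
    (hk : [pchar k] =i pred0 \/ (exists2 p : nat, p \in [pchar k] & (d < p)%N))
    (r n : nat) (hr : (1 < r)%N) (hn : (1 < n)%N) (hnd : (n, d) <> (2%N, 3%N)) :
  ~ exists z : 'I_n.+1 -> {mpoly (ratfun k r)[n]},
      (forall i : 'I_n.+1, is_linear_form (z i)) /\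
      (FracField.tofrac (\sum_(i < r) 'X_i ^+ d : {mpoly k[r]}))%:MP
          * (\sum_(j < n) 'X_j ^+ d)
        = \sum_(i < n.+1) z i ^+ d.
Proof.
case=> z [z_lin zE].
have fact_neq0 := fact_natr_neq0 k d hk.
have d_neq0 : d%:R != 0 :> k.
  apply: contraNneq fact_neq0 => d0.
  by rewrite -(prednK (ltnW (ltnW hd))) factS natrM prednK ?d0 ?mul0r // ltnW // ltnW.
have [c zc] := fin_all_exists z_lin.
set s := FracField.tofrac _ in zE.
have factF : d`!%:R != 0 :> ratfun k r.
  by rewrite -(rmorph_nat (@FracField.tofrac {mpoly k[r]})) tofrac_eq0
    -mpolyC_nat mpolyC_eq0.
have coefE : forall js : seq 'I_n, size js = d ->
    \sum_i \prod_(l <- js) c i l = s * \sum_(j < n) \prod_(l <- js) (j == l)%:R.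
  apply: dth_power_sum_coef => //; rewrite zE.
  by apply: eq_bigr => i _; rewrite zc.
have s_neq f : s != f ^+ d by apply: sum_powers_neq_dth_power => //; apply: ltnW.
have s_neq0 : s != 0.
  by have := s_neq 0; rewrite expr0n gtn_eqF // ltnW // ltnW.
have [] := dth_power_of_decomposition _ n d c s hd s_neq0 _ _ hn hnd.
- move=> j; have := coefE (nseq d j) (size_nseq d j).
  under eq_bigr do rewrite big_nseq iter_mulr_1.
  move=> ->; rewrite (bigD1 j) //= big_nseq iter_mulr_1 eqxx expr1n.
  rewrite big1 ?addr0 ?mulr1 // => m /negPf mj.
  by rewrite big_nseq iter_mulr_1 mj expr0n gtn_eqF // ltnW // ltnW.
- move=> js j l szjs jjs ljs jl; rewrite coefE // big1 ?mulr0 // => m _.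
  apply/eqP; rewrite prodf_seq_eq0; apply/hasP.
  have [mj|mj] := eqVneq m j; last by exists j => //; rewrite (negPf mj) eqxx.
  by exists l => //; rewrite mj (negPf jl) eqxx.
- by move=> f sE; move: (s_neq f); rewrite sE eqxx.
Qed.
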